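(* Let $\mathbf{Ax}'$ be the set of axiom schemas consisting of $\alpha\to\neg\neg\alpha$; $(\circ\alpha\vee\circ\beta)\leftrightarrow\circ(\alpha\wedge\beta)$; $(\circ\alpha\vee\circ\beta)\leftrightarrow\circ(\alpha\vee\beta)$; $(\circ\alpha\vee\circ\beta)\leftrightarrow\circ(\alpha\to\beta)$. Then $$\mathbb{K}_{\mathbf{Ciore}}=\{\mathcal{B}\in\mathbb{K}_{\mathbf{Ci}}:\mathcal{M}(\mathcal{B})\text{ validates all the axioms in }\mathbf{Ax}'\}.$$
   Context: Let $\Sigma=\{\wedge,\vee,\to,\neg,\circ\}$ ($\neg,\circ$ unary, the others binary); $For(\Sigma)$ is the set of formulas over $\Sigma$ generated by a denumerable set of propositional variables, and $\alpha\leftrightarrow\beta$ abbreviates $(\alpha\to\beta)\wedge(\beta\to\alpha)$. A multialgebra over $\Sigma$ is a nonempty set with operations whose values are nonempty subsets. Elements of swap structures are here pairs. For a Boolean algebra $\mathcal{A}$ with domain $A$ (the one-element Boolean algebra is allowed), complement $\sim$, a swap structure for $\mathbf{Ci}$ over $\mathcal{A}$ is a multialgebra $\mathcal{B}$ over $\Sigma$ with domain $|\mathcal{B}|=B\subseteq\{(z_1,z_2)\in A^2:z_1\vee z_2=1\}$ such that $0\in\{z_1:z\in B\}$ and for all $z,w\in B$: $\emptyset\ne z\#w\subseteq\{u\in B:u_1=z_1\#w_1\}$ for $\#\in\{\wedge,\vee,\to\}$; $\emptyset\ne\neg z\subseteq\{u\in B:u_1=z_2\text{ and }u_2\le z_1\}$;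 $\circ z=\{({\sim}(z_1\wedge z_2),z_1\wedge z_2)\}$. $\mathbb{K}_{\mathbf{Ci}}$ is the class of all of these over arbitrary Boolean algebras. $\mathbb{K}_{\mathbf{Ciore}}$ is the class of those $\mathcal{B}\in\mathbb{K}_{\mathbf{Ci}}$ whose multioperations are single-valued and given by $z\#w=\{(z_1\#w_1,\ (z_1\#w_1)\to((z_1\wedge z_2)\wedge(w_1\wedge w_2)))\}$ for $\#\in\{\wedge,\vee,\to\}$, $\neg z=\{(z_2,z_1)\}$, $\circ z=\{({\sim}(z_1\wedge z_2),z_1\wedge z_2)\}$ for all $z,w\in B$. $\mathcal{M}(\mathcal{B})=(\mathcal{B},D_{\mathcal{B}})$ is the Nmatrix with designated set $D_{\mathcal{B}}=\{z\in B:z_1=1\}$. A valuation over $\mathcal{M}(\mathcal{B})$ is $v:For(\Sigma)\to B$ with $v(\alpha\#\beta)\in v(\alpha)\#v(\beta)$, $v(\neg\alpha)\in\neg v(\alpha)$, $v(\circ\alpha)\in\circ v(\alpha)$. $\mathcal{M}(\mathcal{B})$ validates an axiom schema if $v(\gamma)\in D_{\mathcal{B}}$ for every instance $\gamma$ and every valuation $v$. *)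

(* Defs.v *)
From mathcomp Require Import all_boot all_order.
From mathcomp Require Import boolp classical_sets.

Set Implicit Arguments.
Unset Strict Implicit.
Unset Printing Implicit Defensive.

Local Open Scope classical_set_scope.

Variant unop := Neg | Circ.

Variant binop := And | Or | Imp.

Inductive formula :=
  | Var of nat
  | Un of unop & formula
  | Bin of binop & formula & formula.

Definition Iff (a b : formula) : formula := Bin And (Bin Imp a b) (Bin Imp b a).

Fixpoint subst (s : nat -> formula) (a : formula) : formula :=
  match a with
  | Var n => s n
  | Un o b => Un o (subst s b)
  | Bin o b c => Bin o (subst s b) (subst s c)
  end.

(* An axiom schema is represented by a formula whose variables are read as
   metavariables; its instances are its substitution instances. *)
Definition instance (schema : formula) : set formula :=
  [set subst s schema | s in [set: nat -> formula]].

Record multialgebra (T : Type) := Multialgebra {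
  carrier_neq0 : inhabited T;
  un : unop -> T -> set T;
  bin : binop -> T -> T -> set T;
  un_neq0 : forall o z, un o z !=set0;
  bin_neq0 : forall o z w, bin o z w !=set0
}.

Definition valuation (T : Type) (M : multialgebra T) (v : formula -> T) : Prop :=
  (forall o a, un M o (v a) (v (Un o a))) /\
  (forall o a b, bin M o (v a) (v b) (v (Bin o a b))).

(* Boolean algebras are [ctbDistrLatticeType]s, which may have \bot = \top. *)
Definition bool_op {d} {A : ctbDistrLatticeType d} (o : binop) (a b : A) : A :=
  match o with
  | And => Order.meet a b
  | Or => Order.join a b
  | Imp => Order.join (Order.compl a) b
  end.

(* A multialgebra whose domain is a set of pairs over a Boolean algebra; its
   elements have the subtype [set_type domain], with [val] the inclusion. *)
Record pair_multialgebra := PairMultialgebra {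
  disp : Order.disp_t;
  algebra : ctbDistrLatticeType disp;
  domain : set (algebra * algebra);
  multialg :> multialgebra domain
}.

Arguments domain : clear implicits.

Definition fst_ (B : pair_multialgebra) (z : domain B) : algebra B := (val z).1.
Definition snd_ (B : pair_multialgebra) (z : domain B) : algebra B := (val z).2.

Definition conflict (B : pair_multialgebra) (z : domain B) : algebra B :=
  Order.meet (fst_ z) (snd_ z).

Definition circ_pair (B : pair_multialgebra) (z : domain B) :
    algebra B * algebra B :=
  (Order.compl (conflict z), conflict z).

(* Nonemptiness of the values of the operations is part of [multialgebra]. *)
Definition K_Ci (B : pair_multialgebra) : Prop :=
  [/\ forall z : domain B, Order.join (fst_ z) (snd_ z) = \top%O,
      exists z : domain B, fst_ z = \bot%O,
      forall (o : binop) (z w : domain B),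
        bin B o z w `<=` [set u | fst_ u = bool_op o (fst_ z) (fst_ w)],
      forall z : domain B,
        un B Neg z `<=` [set u | fst_ u = snd_ z /\ (snd_ u <= fst_ z)%O] &
      forall z : domain B, val @` un B Circ z = [set circ_pair z]].

(* That the image of an operation's value under the inclusion is a singleton
   asserts both single-valuedness and that the given pair lies in the domain. *)
Definition K_Ciore (B : pair_multialgebra) : Prop :=
  [/\ K_Ci B,
      forall (o : binop) (z w : domain B), val @` bin B o z w =
        [set (bool_op o (fst_ z) (fst_ w),
              bool_op Imp (bool_op o (fst_ z) (fst_ w))
                          (Order.meet (conflict z) (conflict w)))],
      forall z : domain B, val @` un B Neg z = [set (snd_ z, fst_ z)] &
      forall z : domain B, val @` un B Circ z = [set circ_pair z]].

Definition designated (B : pair_multialgebra) : set (domain B) :=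
  [set z | fst_ z = \top%O].

Definition validates (B : pair_multialgebra) (schema : formula) : Prop :=
  forall a, instance schema a ->
  forall v, valuation B v -> designated (v a).

Definition Ax' : set formula :=
  let alpha := Var 0 in
  let beta := Var 1 in
  let lhs := Bin Or (Un Circ alpha) (Un Circ beta) in
  [set s | [\/ s = Bin Imp alpha (Un Neg (Un Neg alpha)),
               s = Iff lhs (Un Circ (Bin And alpha beta)),
               s = Iff lhs (Un Circ (Bin Or alpha beta)) |
               s = Iff lhs (Un Circ (Bin Imp alpha beta))]].

(* Main.v *)
(* Every u in z # w (resp. in \neg z) is realized by a valuation sending two
   variables p, q to z, w and p # q (resp. \neg p) to u; validity under this
   valuation of the axioms propagating consistency says that u_1 /\ u_2 equals
   (z_1 /\ z_2) /\ (w_1 /\ w_2), which together with u_1 \/ u_2 = 1 determines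
   u_2 from u_1, while validity of p -> \neg \neg p gives z_1 <= u_2. *)
Require Import Defs.
From mathcomp Require Import all_boot all_order.
From mathcomp Require Import boolp classical_sets.

Set Implicit Arguments.
Unset Strict Implicit.
Unset Printing Implicit Defensive.

Import Order.TTheory Order.CTBDistrLatticeTheory.
Local Open Scope classical_set_scope.

Section BooleanAlgebra.
Context {d : Order.disp_t} {A : ctbDistrLatticeType d}.
Implicit Types (a b c : A) (o : binop).

Lemma imp_eq_top a b : (bool_op Imp a b = \top)%O <-> (a <= b)%O.
Proof.
rewrite /=; split=> [h|h].
  have: (a `&` (~` a `|` b) <= b)%O by rewrite meetUr meetxC join0x leIr.
  by rewrite h meetx1.
by apply/eqP; rewrite -le1x -(joinCx a) leU2.
Qed.

Lemma meet_imp a b : (a `&` bool_op Imp a b = a `&` b)%O.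
Proof. by rewrite /= meetUr meetxC join0x. Qed.

Lemma imp_meet a b : (a `|` b = \top)%O -> bool_op Imp a (a `&` b)%O = b.
Proof.
move=> h; rewrite /= joinIr joinCx meet1x; apply: join_r.
apply/meet_idPl; move: (congr1 (Order.meet (~` a)%O) h).
by rewrite meetUr meetCx join0x meetx1.
Qed.

(** Each connective dominates a factor of the left side: [a] meet [c], [a] or [c] respectively. *)
Lemma bool_op_meet_le o a b c e :
  (((a `&` b) `&` (c `&` e))%O <= bool_op o a c)%O.
Proof.
case: o => /=.
- by rewrite leI2 // leIl.
- by rewrite (le_trans (leIl _ _)) // (le_trans (leIl _ _)) // leUl.
- by rewrite (le_trans (leIr _ _)) // (le_trans (leIl _ _)) // leUr.
Qed.

End BooleanAlgebra.

(** The valuation is built by recursion on formulas, preferring [u] wherever it is an allowed value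
    and choosing arbitrarily elsewhere. *)
Lemma valuation_extend (T : Type) (M : multialgebra T) (s : nat -> T) (u : T) :
  exists v, [/\ valuation M v, forall n, v (Var n) = s n,
    forall o a, un M o (v a) u -> v (Un o a) = u &
    forall o a b, bin M o (v a) (v b) u -> v (Bin o a b) = u].
Proof.
pose pick (P : set T) (h : P !=set0) :=
  if pselect (P u) then u else sval (cid h).
have pickP P h : P (@pick P h).
  by rewrite /pick; case: pselect => [//|nPu]; exact: (svalP (cid h)).
have pick_u P h : P u -> @pick P h = u.
  by rewrite /pick; case: pselect => [//|nPu Pu].
pose v := fix v f := match f with
  | Var n => s n
  | Un o a => pick _ (un_neq0 M o (v a))
  | Bin o a b => pick _ (bin_neq0 M o (v a) (v b))
  end.
exists v; split=> //=; first by split=> [o a|o a b]; exact: pickP.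
- by move=> o a; exact: pick_u.
- by move=> o a b; exact: pick_u.
Qed.

Lemma image_val_set1 (T : Type) (D : set T) (Q : set D) (p : T) :
  Q !=set0 -> (forall u, Q u -> val u = p) -> val @` Q = [set p].
Proof.
move=> [u Qu] h; apply/seteqP; split=> [_ [w Qw <-]|_ ->] /=; first exact: h.
by exists u; [|exact: h].
Qed.

Lemma val_image_set1 (T : Type) (D : set T) (Q : set D) (p : T) (u : D) :
  val @` Q = [set p] -> Q u -> val u = p.
Proof. by move=> h Qu; have : [set p] (val u) by rewrite -h; exists u. Qed.

Lemma validates_schema (B : pair_multialgebra) s v :
  validates B s -> valuation B v -> designated (v s).
Proof.
(* A schema is its own instance under the identity substitution. *)
move=> h /(h s); apply; exists Var => //.
by elim: s {h} => //= [o a ->|o a -> b ->].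
Qed.

Section Ci.
Context {B : pair_multialgebra} (KB : K_Ci B).
Implicit Types (v : formula -> domain B) (a b : formula).

Lemma fst_bin v o a b : valuation B v ->
  fst_ (v (Bin o a b)) = bool_op o (fst_ (v a)) (fst_ (v b)).
Proof. by case: KB => _ _ h _ _ [_ vb]; exact: h (vb o a b). Qed.

Lemma fst_neg v a : valuation B v -> fst_ (v (Un Neg a)) = snd_ (v a).
Proof. by case: KB => _ _ _ h _ [vu _]; case: (h _ _ (vu Neg a)). Qed.

Lemma fst_circ v a : valuation B v ->
  fst_ (v (Un Circ a)) = (~` conflict (v a))%O.
Proof.
case: KB => _ _ _ _ h [vu _].
by rewrite /fst_ (val_image_set1 (h _) (vu Circ a)).
Qed.

Lemma designated_imp v a b : valuation B v ->
  designated (v (Bin Imp a b)) <-> (fst_ (v a) <= fst_ (v b))%O.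
Proof. by move=> vv; rewrite /designated /= fst_bin //; exact: imp_eq_top. Qed.

Lemma designated_iff v a b : valuation B v ->
  designated (v (Iff a b)) <-> fst_ (v a) = fst_ (v b).
Proof.
move=> vv; rewrite /designated /= fst_bin //=; split=> [/eqP|e].
  rewrite meet_eq1 => /andP[/eqP /(designated_imp _ _ vv) h].
  by move=> /eqP /(designated_imp _ _ vv) h'; apply/le_anti/andP.
by apply/eqP; rewrite meet_eq1; apply/andP; split; apply/eqP;
  apply/(designated_imp _ _ vv); rewrite e.
Qed.

(** By De Morgan the left side of the biconditional has as first coordinate the complement of the
    meet of the conflicts, and complementation is injective. *)
Lemma designated_circ_bin v o a b : valuation B v ->
  designated (v (Iff (Bin Or (Un Circ a) (Un Circ b)) (Un Circ (Bin o a b))))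
  <-> conflict (v (Bin o a b)) = (conflict (v a) `&` conflict (v b))%O.
Proof.
move=> vv; apply: (iff_trans (designated_iff _ _ vv)).
rewrite fst_bin // !fst_circ //= -complI.
by split=> [/compl_inj|] ->.
Qed.

End Ci.

Lemma K_Ciore_validates (B : pair_multialgebra) s :
  K_Ciore B -> Ax' s -> validates B s.
Proof.
case=> KB hbin hneg _ hs _ [t _ <-] v vv.
have confl o a b :
    conflict (v (Bin o a b)) = (conflict (v a) `&` conflict (v b))%O.
  have e := val_image_set1 (hbin _ _ _) (vv.2 o a b).
  rewrite /conflict /fst_ /snd_ e meet_imp.
  (* The implication in the second coordinate has cancelled against the first; what remains is that
     the meet of the conflicts lies below the first coordinate. *)
  by apply: meet_r; exact: bool_op_meet_le.
case: hs => -> /=; try by apply/designated_circ_bin.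
apply/designated_imp => //; rewrite fst_neg //.
by rewrite /snd_ (val_image_set1 (hneg _) (vv.1 Neg _)).
Qed.

Section Completeness.
Context {B : pair_multialgebra} (KB : K_Ci B).
Hypothesis valid : forall s, Ax' s -> validates B s.

Lemma conflict_bin o z w u : bin B o z w u ->
  conflict u = (conflict z `&` conflict w)%O.
Proof.
move=> zwu.
have [v [vv vV _ vB]] :=
  valuation_extend B (fun n => if n is 0 then z else w) u.
have <- : v (Bin o (Var 0) (Var 1)) = u by apply: vB; rewrite !vV.
have -> : z = v (Var 0) by rewrite vV.
have -> : w = v (Var 1) by rewrite vV.
apply/(designated_circ_bin KB) => //; apply: validates_schema => //.
apply: valid; case: o {zwu}.
- exact: Or42.
- exact: Or43.
- exact: Or44.
Qed.

Lemma fst_le_snd_neg z u : un B Neg z u -> (fst_ z <= snd_ u)%O.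
Proof.
move=> zu; have [v [vv vV vU _]] := valuation_extend B (fun=> z) u.
have <- : v (Un Neg (Var 0)) = u by apply: vU; rewrite vV.
(* [snd_ u] becomes the first coordinate of the value of the double negation. *)
rewrite -(vV 0) -(fst_neg KB _ vv); apply/(designated_imp KB) => //.
by apply: validates_schema => //; apply: valid; exact: Or41.
Qed.

End Completeness.

Theorem proposition9p20 (B : pair_multialgebra) :
  K_Ciore B <-> K_Ci B /\ (forall s, Ax' s -> validates B s).
Proof.
split=> [KB|[KB valid]].
  by split=> [|s]; [case: KB|exact: K_Ciore_validates].
have [jT _ hbin hneg hcirc] := KB; split=> //.
- move=> o z w; apply: image_val_set1; first exact: bin_neq0.
  move=> u zwu; rewrite -(conflict_bin KB valid zwu) -(hbin _ _ _ _ zwu).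
  (* The prescribed second coordinate is now [fst_ u] implies [conflict u], which is [snd_ u]. *)
  by rewrite /conflict imp_meet //; exact: surjective_pairing.
- move=> z; apply: image_val_set1; first exact: un_neq0.
  move=> u zu; have [u1 u2] := hneg _ _ zu.
  rewrite [LHS]surjective_pairing -u1; congr pair.
  (* One inequality is built into [K_Ci]; the other comes from the double negation axiom. *)
  by apply/le_anti/andP; split; [exact: u2|exact: (fst_le_snd_neg KB valid)].
Qed.
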